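(* There exist speed limits $v_1\ge v_2\ge\dots\ge v_k>0$ and movements of $k$ agents with these speed limits that patrol (unidirectionally, with idle time $1$) a circle of perimeter $1.05\max_{1\le r\le k} r v_r$.
   Context: A circle of perimeter $L$ is identified with $\mathbb{R}/L\mathbb{Z}$. A movement of an agent with speed limit $v$ is a function $p\colon\mathbb{R}\to\mathbb{R}$ with $0\le p(t)-p(s)\le v(t-s)$ for all $s\le t$ (the agent is at $p(t)\bmod L$ at time $t$ and may only move clockwise). Agents with movements $p_1,\dots,p_k$ patrol the circle (with idle time $1$) if for every point $x\in\mathbb{R}/L\mathbb{Z}$ and every $t\in\mathbb{R}$ there are $i$ and $t'\in[t,t+1)$ with $p_i(t')\equiv x\pmod L$. *)

(* Defs.v *)
From mathcomp Require Import all_boot all_order all_algebra.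
From mathcomp Require Import reals.

Set Implicit Arguments.
Unset Strict Implicit.
Unset Printing Implicit Defensive.

Import Order.TTheory GRing.Theory Num.Theory.
Local Open Scope ring_scope.

Section Patrolling.
Variable R : realType.

Definition movement (v : R) (p : R -> R) : Prop :=
  forall s t : R, s <= t -> 0 <= p t - p s <= v * (t - s).

(* x = y in R/LZ; points of the circle are handled through representatives
   in R. *)
Definition eq_circle (L x y : R) : Prop := exists m : int, x - y = m%:~R * L.

Definition patrols (k : nat) (L : R) (p : 'I_k -> R -> R) : Prop :=
  forall x t : R, exists (i : 'I_k) (t' : R),
    t <= t' < t + 1 /\ eq_circle L (p i t') x.

(* The maximum of r * v_r over 1 <= r <= k. Agents are indexed from 0, so v_r
   is v i with r = i.+1; the default value 0 of the iterated maximum is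
   irrelevant for k > 0 and positive speeds. *)
Definition max_rv (k : nat) (v : 'I_k -> R) : R :=
  \big[Num.max/0]_(i < k) (i.+1%:R * v i).

End Patrolling.

(* Main.v *)
Require Import Defs.
From mathcomp Require Import all_boot all_order all_algebra.
From mathcomp Require Import reals.
From mathcomp Require Import zify ring lra.

(** Take twelve agents with speeds 1, 1/2, ..., 1/12, so that every [r * v_r]
    is 1, on a circle of perimeter 21/20. With 1/20 as the unit ("cell", "tick")
    of both length and time, the perimeter is 21 and the idle time 20. The
    fastest agent runs at constant speed and is at [t] at time [t], so each
    point is left unvisited for 21 ticks; it suffices that some slower agent
    visits it between 1 and 20 ticks after each visit of the fastest one. If
    agent [i] crosses the cell [[c, c + 1]] at full speed during [[s, s + i]],
    it does so for all points of the cell as soon as [1 <= s - c <= 21 - i].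
    There is a schedule of the slower agents, found by computer search and
    invariant under [(t, x) -> (t + 294, x + 294)], in which every pair of a
    cell and a round of the fastest agent is served in this way; checking it is
    a finite computation. *)

Set Implicit Arguments.
Unset Strict Implicit.
Unset Printing Implicit Defensive.

Import Order.TTheory GRing.Theory Num.Theory.
Local Open Scope ring_scope.

Section Interpolation.
Variable R : realType.

Definition interp (G : int -> int) (t : R) : R :=
  let n := Num.floor t in (G n)%:~R + (t - n%:~R) * (G (n + 1) - G n)%:~R.

Lemma interp_int (G : int -> int) (n : int) : interp G n%:~R = (G n)%:~R.
Proof. by rewrite /interp intrKfloor subrr mul0r addr0. Qed.

Lemma step_homo (G : int -> int) :
  (forall n, G n <= G (n + 1)) -> {homo G : m n / m <= n}.
Proof.
move=> Gstep m n le_mn.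
have -> : n = m + `|n - m|%N by lia.
elim: `|n - m|%N => [|d IHd]; first by rewrite addr0.
by rewrite -addn1 PoszD addrA (le_trans IHd).
Qed.

Lemma interp_homo (G : int -> int) :
  (forall n, G n <= G (n + 1)) -> {homo interp G : s t / s <= t}.
Proof.
move=> Gstep s t le_st; rewrite /interp.
have /andP[s_ge s_lt] := floor_itv s; have /andP[t_ge t_lt] := floor_itv t.
set m := Num.floor s in s_ge s_lt *; set n := Num.floor t in t_ge t_lt *.
have le_mn : m <= n by apply: le_floor.
have Gm : 0 <= (G (m + 1) - G m)%:~R :> R by rewrite ler0z subr_ge0.
have Gn : 0 <= (G (n + 1) - G n)%:~R :> R by rewrite ler0z subr_ge0.
have [eq_mn|lt_mn] := eqVneq m n.
  rewrite eq_mn lerD2l ler_wpM2r //; lra.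
(* For [m < n] the node value at [m + 1] separates the two interpolated values. *)
have Gmn : (G m)%:~R + (G (m + 1) - G m)%:~R <= (G n)%:~R :> R.
  rewrite -intrD ler_int addrC subrK; apply: step_homo => //; lia.
move: s_lt; rewrite intrD => s_lt.
have h1 : (s - m%:~R) * (G (m + 1) - G m)%:~R <= (G (m + 1) - G m)%:~R.
  by rewrite ler_piMl //; lra.
have h2 : 0 <= (t - n%:~R) * (G (n + 1) - G n)%:~R.
  by rewrite mulr_ge0 //; lra.
lra.
Qed.

Lemma interp_subr (G : int -> int) (t : R) :
  interp (fun n => n - G n) t = t - interp G t.
Proof. by rewrite /interp !(intrD, intrN) /=; ring. Qed.

(** The upper bound is monotonicity of the interpolation of [n - G n]. *)
Lemma interp_lipschitz (G : int -> int) (s t : R) :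
  (forall n, G n <= G (n + 1) <= G n + 1) -> s <= t ->
  0 <= interp G t - interp G s <= t - s.
Proof.
move=> Gstep le_st.
have le_G : interp G s <= interp G t.
  by apply: interp_homo => // n; case/andP: (Gstep n).
have le_idG : interp (fun n => n - G n) s <= interp (fun n => n - G n) t.
  by apply: interp_homo => // n; have /andP[] := Gstep n; lia.
rewrite !interp_subr in le_idG; lra.
Qed.

(** A gain of [d] over length [d] at slope at most 1 leaves no slack in between. *)
Lemma interp_full_speed (G : int -> int) (n : int) (d : nat) (t : R) :
  (forall n, G n <= G (n + 1) <= G n + 1) -> G (n + d) = G n + d ->
  0 <= t <= d%:R -> interp G (n%:~R + t) = (G n)%:~R + t.
Proof.
move=> Gstep Gnd /andP[t_ge0 t_le].
have le1 : n%:~R <= n%:~R + t by lra.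
have le2 : n%:~R + t <= (n + d)%:~R by rewrite intrD -pmulrn; lra.
have := interp_lipschitz Gstep le1; have := interp_lipschitz Gstep le2.
rewrite !interp_int Gnd !intrD -!pmulrn; lra.
Qed.

Lemma movement_interp (G : int -> int) (c v : R) :
  0 < c -> 0 <= v -> (forall n, G n <= G (n + 1) <= G n + 1) ->
  movement v (fun t => v / c * interp G (c * t)).
Proof.
move=> c_gt0 v_ge0 Gstep s t le_st.
have le_c : c * s <= c * t by rewrite ler_pM2l.
have /andP[h0 h1] := interp_lipschitz Gstep le_c.
have vc_ge0 : 0 <= v / c by rewrite divr_ge0 // ltW.
rewrite -mulrBr mulr_ge0 //=.
have -> : v * (t - s) = v / c * (c * t - c * s) by field; rewrite gt_eqF.
by rewrite ler_wpM2l.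
Qed.

End Interpolation.

(** The word [b] is repeated over all integer ticks, [true] meaning one unit forward; the division
    rounds down, so negative times are covered too. *)
Definition schedule (b : seq bool) (x0 : nat) (n : int) : int :=
  x0%:Z + (n %/ size b)%Z * count id b + count id (take `|(n %% size b)%Z|%N b).

(** Allowing [r = size b] handles a step across the end of a period. *)
Lemma scheduleE (b : seq bool) (x0 : nat) (q : int) (r : nat) :
  (0 < size b)%N -> (r <= size b)%N ->
  schedule b x0 (q * size b + r) = x0%:Z + q * count id b + count id (take r b).
Proof.
move=> b_gt0; have b_neq0 : (size b : int) != 0 by lia.
rewrite leq_eqVlt => /predU1P[->|lt_r]; rewrite /schedule.
  have -> : q * size b + size b = (q + 1) * size b + 0 by ring.
  rewrite divzMDl // modzMDl div0z mod0z take0 take_size /=; ring.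
by rewrite divzMDl // modzMDl divz_nat modz_nat divn_small // modn_small // addr0.
Qed.

Lemma schedule_period (b : seq bool) (x0 : nat) (k n : int) :
  (0 < size b)%N ->
  schedule b x0 (k * size b + n) = k * count id b + schedule b x0 n.
Proof.
move=> b_gt0; have b_neq0 : (size b : int) != 0 by lia.
by rewrite /schedule divzMDl // modzMDl; ring.
Qed.

Lemma schedule_step (b : seq bool) (x0 : nat) (n : int) : (0 < size b)%N ->
  schedule b x0 n <= schedule b x0 (n + 1) <= schedule b x0 n + 1.
Proof.
move=> b_gt0; rewrite (divz_eq n (size b)).
have := modz_ge0 n (_ : (size b : int) != 0); have := ltz_pmod n (_ : 0 < (size b : int)).
case: (n %% _)%Z => [r|r] //; last by lia.
move=> /(_ ltac:(lia)) lt_r _.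
rewrite -addrA -PoszD addn1 !scheduleE //; try lia.
rewrite (take_nth false); last by lia.
rewrite -cats1 count_cat /=; case: nth => /=; lia.
Qed.

(* Entry [j] describes agent [j.+1]: its position at time 0, in units of
   [1 / j.+1] of a cell, and the alternating numbers of ticks during which it
   moves at full speed and stands still; together they fill a period of 294. *)
Definition fleet : seq (nat * seq (nat * nat)) := [::
  (0, [:: (294, 0)]);
  (0, [:: (294, 0)]);
  (46, [:: (14, 12); (42, 8); (63, 22); (133, 0)]);
  (37, [:: (27, 11); (220, 31); (5, 0)]);
  (0, [:: (0, 1); (40, 34); (20, 23); (50, 23); (100, 3)]);
  (20, [:: (178, 33); (30, 7); (24, 2); (20, 0)]);
  (38, [:: (294, 0)]);
  (160, [:: (8, 61); (120, 56); (32, 9); (8, 0)]);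
  (67, [:: (5, 35); (54, 44); (72, 26); (58, 0)]);
  (120, [:: (0, 26); (140, 35); (70, 23)]);
  (157, [:: (85, 57); (143, 6); (3, 0)]);
  (149, [:: (31, 6); (24, 36); (197, 0)])]%N.

Definition steps (j : nat) : seq bool :=
  flatten [seq nseq r.1 true ++ nseq r.2 false | r <- (nth (0%N, [::]) fleet j).2].

Definition progress (j : nat) : int -> int :=
  schedule (steps j) (nth (0%N, [::]) fleet j).1.

(* During the ticks from [s] to [s + j.+1], agent [j.+1] crosses exactly the
   cell [c], modulo the perimeter. *)
Definition sweeps (j : nat) (c s : int) : bool :=
  (21 * j.+1%:Z %| progress j s - j.+1%:Z * c)%Z
  && (progress j (s + j.+1) == progress j s + j.+1).

Lemma fleet_check :
  all (fun c : nat => has (fun j => has (fun d => sweeps j c (c + d)%N)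
    (iota 1 (20 - j))) (iota 1 11)) (iota 0 294).
Proof. by vm_compute. Qed.

(** A lap is [21 * j.+1] units of agent [j.+1], so each agent makes whole laps in a period; this
    lets [fleet_check] stop at 294 cells. *)
Lemma fleet_period : all (fun j => (size (steps j) == 294%N)
  && (21 * j.+1 %| count id (steps j))%N) (iota 0 12).
Proof. by vm_compute. Qed.

Lemma fleet_covers (c : int) : exists (j : 'I_12) (s : int),
  c + 1 <= s <= c + 20 - j%:Z /\ sweeps j c s.
Proof.
have [q [r [lt_r ->]]] : exists (q : int) (r : nat), (r < 294)%N /\ c = q * 294 + r.
  by exists (c %/ 294)%Z, `|(c %% 294)%Z|%N; lia.
have /allP/(_ r) := fleet_check; rewrite mem_iota => /(_ lt_r).
case/hasP=> j; rewrite mem_iota => j_bnd /hasP[d]; rewrite mem_iota => d_bnd.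
have lt_j : (j < 12)%N by lia.
have /allP/(_ j) := fleet_period; rewrite mem_iota => /(_ lt_j).
case/andP=> /eqP size_j count_j /andP[dvd_j full_j].
exists (Ordinal lt_j), (q * 294 + (r + d)%N); split; first by rewrite /=; lia.
have progressE n : progress j (q * 294 + n) = q * count id (steps j) + progress j n.
  by rewrite /progress -schedule_period size_j.
have progress_full : progress j (q * 294 + (r + d)%N + j.+1) =
    progress j (q * 294 + (r + d)%N) + j.+1.
  by rewrite -(addrA (q * 294)) !progressE (eqP full_j); ring.
rewrite /sweeps /= progress_full eqxx andbT progressE.
(* As 294 = 14 * 21, moving the cell by [q] periods is [14 * q] laps. *)
have -> : q * count id (steps j) + progress j (r + d)%N - j.+1%:Z * (q * 294 + r) =
   q * count id (steps j) + (progress j (r + d)%N - j.+1%:Z * r)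
   - q * 14 * (21 * j.+1%:Z) by ring.
apply: rpredB; last exact: dvdz_mull.
by apply: rpredD => //; apply: dvdz_mull.
Qed.

Lemma progress0 (n : int) : progress 0 n = n.
Proof.
have steps0 : steps 0 = nseq 294 true by [].
rewrite /progress /schedule steps0 size_nseq take_nseq; last by lia.
by rewrite !count_nseq /=; lia.
Qed.

Lemma progress_step (j : 'I_12) (n : int) :
  progress j n <= progress j (n + 1) <= progress j n + 1.
Proof.
have /allP/(_ (val j)) := fleet_period; rewrite mem_iota => /(_ (ltn_ord j)).
by case/andP=> /eqP size_j _; apply: schedule_step; rewrite size_j.
Qed.

Section Fleet.
Variable R : realType.

Definition speed (j : 'I_12) : R := j.+1%:R^-1.

Definition position (j : 'I_12) (t : R) : R :=
  speed j / 20 * interp (progress j) (20 * t).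

Lemma fleet_patrols : patrols (21 / 20) position.
Proof.
move=> x t.
(* [z] is the tick in [[20 t, 20 t + 21)] at which the fastest agent visits [x]. *)
pose f := Num.floor ((20 * x - 20 * t) / 21); pose z := 20 * x - 21 * f%:~R.
have /andP[f_ge f_lt] := floor_itv ((20 * x - 20 * t) / 21).
rewrite -/f intrD in f_ge f_lt.
have z_ge : 20 * t <= z by rewrite /z; lra.
have z_lt : z < 20 * t + 21 by rewrite /z; lra.
have [lt_z|le_z] := ltP z (20 * t + 20).
  exists ord0, (z / 20); split; first by lra.
  exists (- f); rewrite /position /speed /= (_ : 20 * (z / 20) = z); last by field.
  by rewrite /interp !progress0 intrN /z; field.
pose u := z - (Num.floor z)%:~R.
have /andP[u_ge u_lt] := floor_itv z; rewrite intrD in u_lt.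
have u_ge0 : 0 <= u by rewrite /u; lra.
have u_lt1 : u < 1 by rewrite /u; lra.
have zE : z = (Num.floor z)%:~R + u by rewrite /u; ring.
(* The fastest agent is too late, and its previous visit was at [z - 21]. A slower one follows
   between [z - 20] and [z - 1], hence within [[20 t, 20 t + 20)]. *)
have [j [s [/andP[s_ge s_le]]]] := fleet_covers (Num.floor z - 21).
case/andP=> /dvdzP[e se] /eqP full_j.
have {}s_ge : (Num.floor z)%:~R - 20 <= s%:~R :> R.
  by rewrite -[20]/(20%:~R) -intrB ler_int; lia.
have {}s_le : s%:~R <= (Num.floor z)%:~R - 1 - j%:R :> R.
  by rewrite -[j%:R]/(j%:~R) -[1]/(1%:~R) -!intrB ler_int; lia.
have j_ge0 : 0 <= j%:R :> R by [].
have ju : 0 <= j%:R * u <= j%:R by rewrite mulr_ge0 //= ler_piMr // ltW.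
have jS : j.+1%:R = j%:R + 1 :> R by rewrite -natr1.
exists j, ((s%:~R + j.+1%:R * u) / 20); split; first by rewrite jS mulrDl; lra.
(* Laps: [e] from the divisibility in [sweeps], [- f] from [x] to [z], [- 1] for the previous
   round. *)
exists (e - f - 1).
rewrite /position (_ : 20 * (_ / 20) = s%:~R + j.+1%:R * u); last by field.
rewrite (interp_full_speed (progress_step j) full_j); last first.
  by rewrite mulr_ge0 //= ler_piMr // ltW.
have -> : progress j s = j.+1%:Z * (Num.floor z - 21 + 21 * e).
  by move/eqP: se; rewrite subr_eq => /eqP ->; ring.
have -> : x = (z + 21 * f%:~R) / 20 by rewrite /z; field.
rewrite {2}zE /speed !(intrM, intrD, intrN) -!pmulrn; field.
by rewrite nat1r pnatr_eq0.
Qed.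

Lemma max_rv_speed : max_rv speed = 1.
Proof.
rewrite /max_rv (eq_bigr (fun=> 1)) => [|i _]; last by rewrite mulfV // pnatr_eq0.
(* The induction starts at one term, since an empty maximum would be the default 0. *)
rewrite big_const_ord -[12%N]/(11.+1); elim: 11%N => [|n IHn].
  by rewrite /= max_l.
by rewrite iterS IHn maxxx.
Qed.

End Fleet.

Theorem theorem3 (R : realType) :
  exists (k : nat) (v : 'I_k -> R) (p : 'I_k -> R -> R),
    (0 < k)%N
    /\ (forall i j : 'I_k, (i <= j)%N -> v j <= v i)
    /\ (forall i : 'I_k, 0 < v i)
    /\ (forall i : 'I_k, movement (v i) (p i))
    /\ patrols (105 / 100 * max_rv v) p.
Proof.
exists 12, (@speed R), (@position R).
have speed_gt0 (i : 'I_12) : 0 < speed R i by rewrite invr_gt0 ltr0n.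
split=> //; split=> [i j le_ij|]; first by rewrite lef_pV2 ?posrE ?ltr0n // ler_nat.
split=> //; split=> [i|].
  by apply: movement_interp; rewrite ?(ltW (speed_gt0 i)) //; apply: progress_step.
have -> : 105 / 100 * max_rv (@speed R) = 21 / 20 by rewrite max_rv_speed; field.
exact: fleet_patrols.
Qed.
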